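(* Let $((\mathfrak g,[\cdot,\cdot]_{\mathfrak g}),(V;\rho),T)$ be a Lie-Leibniz triple, and let $\omega\in\mathrm{Hom}(\wedge^2\mathfrak g,\mathfrak g)$, $\varrho\in\mathrm{Hom}(\mathfrak g\otimes V,V)$, $\mathcal T\in\mathrm{Hom}(V,\mathfrak g)$. Then $(\omega,\varrho,\mathcal T)$ generates an infinitesimal deformation of $((\mathfrak g,[\cdot,\cdot]_{\mathfrak g}),(V;\rho),T)$ if and only if $(\omega,\varrho,\mathcal T)$ is a $2$-cocycle of the Lie-Leibniz triple, i.e. $\mathcal D(\omega,\varrho,\mathcal T)=0$ in the regular cochain complex $(\mathfrak C^\bullet(\mathfrak g,\rho,T),\mathcal D)$.
   Context: A Lie-Leibniz triple $((\mathfrak g,[\cdot,\cdot]_{\mathfrak g}),(V;\rho),T)$ consists of a Lie algebra $\mathfrak g$ over a field $\mathbb K$, a representation $\rho:\mathfrak g\to\mathfrak{gl}(V)$, and a linear map $T:V\to\mathfrak g$ with $[Tu,Tv]_{\mathfrak g}=T(\rho(Tu)v)$ for all $u,v\in V$. Infinitesimal deformation: $(\omega,\varrho,\mathcal T)$ generates an infinitesimal deformation if, extending everything $\mathbb K[[t]]/(t^2)$-linearly, $[\cdot,\cdot]_t=[\cdot,\cdot]_{\mathfrak g}+t\omega$ is a Lie algebra structure on $\mathfrak g[[t]]/(t^2)$, $\rho_t=\rho+t\varrho$ is a representation of this Lie algebra on $V[[t]]/(t^2)$, and $T_t=T+t\mathcal T$ satisfies $[T_tu,T_tv]_t=T_t(\rho_t(T_tu)(v))$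 for all $u,v\in V$ (equalities modulo $t^2$). Regular complex: $\mathfrak C^0=0$ and for $n\ge1$, $\mathfrak C^n(\mathfrak g,\rho,T)=\mathrm{Hom}(\wedge^n\mathfrak g,\mathfrak g)\oplus\mathrm{Hom}(\wedge^{n-1}\mathfrak g\otimes V,V)\oplus\mathrm{Hom}(\otimes^{n-1}V,\mathfrak g)$. For $f=(f_{\mathfrak g},f_V)$ and $\theta$, $\mathcal D(f,\theta)=(\delta f,\partial_T\theta+\Omega_Tf)$, where $\delta f=((\delta f)_{\mathfrak g},(\delta f)_V)$, $(\delta f)_{\mathfrak g}=\mathrm d_{CE}f_{\mathfrak g}$ is the Chevalley-Eilenberg coboundary with adjoint coefficients, $$\begin{aligned}(\delta f)_V(x_1,\dots,x_n,v)=&\sum_{1\le i<j\le n}(-1)^if_V(x_1,\dots,\hat x_i,\dots,x_{j-1},[x_i,x_j]_{\mathfrak g},x_{j+1},\dots,x_n,v)+(-1)^{n-1}\rho(f_{\mathfrak g}(x_1,\dots,x_n))v\\&+\sum_{i=1}^n(-1)^{i+1}\big(\rho(x_i)f_V(x_1,\dots,\hat x_i,\dots,x_n,v)-f_V(x_1,\dots,\hat x_i,\dots,x_n,\rho(x_i)v)\big),\end{aligned}$$ for $\theta\in\mathrm{Hom}(\otimes^kV,\mathfrak g)$, $$\begin{aligned}\partial_T\theta(u_1,\dots,u_{k+1})=&\sum_{i=1}^k(-1)^{i+1}[Tu_i,\theta(u_1,\dots,\hat u_i,\dots,u_{k+1})]_{\mathfrak g}+(-1)^{k+1}[\theta(u_1,\dots,u_k),Tu_{k+1}]_{\mathfrak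 g}\\&+(-1)^kT(\rho(\theta(u_1,\dots,u_k))u_{k+1})+\sum_{1\le i<j\le k+1}(-1)^i\theta(u_1,\dots,\hat u_i,\dots,u_{j-1},\rho(Tu_i)u_j,u_{j+1},\dots,u_{k+1}),\end{aligned}$$ and $\Omega_T(f_{\mathfrak g},f_V)(v_1,\dots,v_n)=(-1)^n\big(f_{\mathfrak g}(Tv_1,\dots,Tv_n)-Tf_V(Tv_1,\dots,Tv_{n-1},v_n)\big)$. *)

(* Defs.v *)
From HB Require Import structures.
From mathcomp Require Import all_boot all_order all_algebra.
Set Implicit Arguments.
Unset Strict Implicit.
Unset Printing Implicit Defensive.
Import GRing.Theory.
Local Open Scope ring_scope.

Section LieAlgebras.

Variables (R : comNzRingType) (g V : lmodType R).

Record is_lie_bracket (br : g -> g -> g) : Prop := IsLieBracket {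
  lie_bilinear : bilinear_for *:%R *:%R br;
  lie_alternating : forall x, br x x = 0;
  lie_jacobi : forall x y z,
    br x (br y z) + br y (br z x) + br z (br x y) = 0 }.

Record is_lie_rep (br : g -> g -> g) (rho : g -> V -> V) : Prop := IsLieRep {
  rep_bilinear : bilinear_for *:%R *:%R rho;
  rep_bracket : forall x y v,
    rho (br x y) v = rho x (rho y v) - rho y (rho x v) }.

Record is_lie_leibniz_triple (br : g -> g -> g) (rho : g -> V -> V)
    (T : {linear V -> g}) : Prop := IsLieLeibnizTriple {
  triple_lie : is_lie_bracket br;
  triple_rep : is_lie_rep br rho;
  triple_leibniz : forall u v, br (T u) (T v) = T (rho (T u) v) }.

End LieAlgebras.

(* K[[t]]/(t^2) = K[t]/(t^2) is the library's {poly %/ 'X^2}, with t = 'qX.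
   The element (x0, x1) of trunc V = V[[t]]/(t^2) stands for x0 + t x1. *)
Notation trunc_ring K := {poly %/ ('X^2 : {poly K})}.

Definition trunc (K : fieldType) (V : lmodType K) : Type := (V * V)%type.

HB.instance Definition _ (K : fieldType) (V : lmodType K) :=
  GRing.Zmodule.on (trunc V).

Section Truncation.

Variable K : fieldType.

Lemma coef_rmodpX2 (p : {poly K}) i :
  (i < 2)%N -> (Pdiv.CommonRing.rmodp p (mk_monic 'X^2))`_i = p`_i.
Proof.
move=> lt_i2; rewrite mk_monic_Xn [in RHS](Pdiv.RingMonic.rdivp_eq (monicXn _ 2) p).
by rewrite coefD coefMXn lt_i2 add0r.
Qed.

Lemma coef_trunc_mul (p q : trunc_ring K) :
  ((p * q)`_0 = p`_0 * q`_0) * ((p * q)`_1 = p`_0 * q`_1 + p`_1 * q`_0).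
Proof.
by split; rewrite poly_of_qpolyM coef_rmodpX2 // coefM !big_ord_recl big_ord0
  addr0.
Qed.

Lemma coef_trunc_t :
  (('qX : trunc_ring K)`_0 = 0) * (('qX : trunc_ring K)`_1 = 1).
Proof.
rewrite qpolyXE ?size_polyXn ?monicXn //.
by rewrite !coefX.
Qed.

Section Module.

Variable V : lmodType K.

Definition trunc_scale (p : trunc_ring K) (x : trunc V) : trunc V :=
  (p`_0 *: x.1, p`_0 *: x.2 + p`_1 *: x.1).

Fact trunc_scaleA p q x :
  trunc_scale p (trunc_scale q x) = trunc_scale (p * q) x.
Proof.
rewrite /trunc_scale /= !coef_trunc_mul !scalerA; congr pair.
by rewrite scalerDr scalerDl !scalerA addrA.
Qed.

Fact trunc_scale1 : left_id 1 trunc_scale.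
Proof.
case=> x0 x1; rewrite /trunc_scale (_ : polyn 1 = 1%:P) ?coefC //=.
by rewrite !scale1r scale0r addr0.
Qed.

Fact trunc_scaleDr : right_distributive trunc_scale +%R.
Proof.
by move=> p [x0 x1] [y0 y1]; congr pair; rewrite /= !scalerDr // addrACA.
Qed.

Fact trunc_scaleDl x : {morph trunc_scale^~ x : p q / p + q}.
Proof.
case: x => x0 x1 p q; rewrite /trunc_scale /= !coefD !scalerDl.
by congr pair; rewrite addrACA.
Qed.

HB.instance Definition _ := GRing.Zmodule_isLmodule.Build (trunc_ring K)
  (trunc V) trunc_scaleA trunc_scale1 trunc_scaleDr trunc_scaleDl.

Definition trunc_const (x : V) : trunc V := (x, 0).

Lemma trunc_tE (x : trunc V) : 'qX *: x = (0, x.1) :> trunc V.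
Proof.
rewrite /GRing.scale /= /trunc_scale !coef_trunc_t.
by rewrite !scale0r scale1r add0r.
Qed.

Lemma truncE (x : trunc V) :
  x = trunc_const x.1 + 'qX *: trunc_const x.2 :> trunc V.
Proof.
by case: x => x0 x1; rewrite trunc_tE; congr pair; rewrite /= ?addr0 ?add0r.
Qed.

End Module.

(* The K[[t]]/(t^2)-(bi)linear extensions of (bi)linear maps. *)
Definition trunc_ext1 (U V : lmodType K) (f : U -> V) (x : trunc U) : trunc V :=
  (f x.1, f x.2).

Definition trunc_ext2 (U V W : lmodType K) (b : U -> V -> W)
    (x : trunc U) (y : trunc V) : trunc W :=
  (b x.1 y.1, b x.1 y.2 + b x.2 y.1).

Lemma trunc_ext1_linear (U V : lmodType K) (f : {linear U -> V}) :
  linear (trunc_ext1 f).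
Proof.
move=> p [x0 x1] [y0 y1]; congr pair; rewrite /=.
  by rewrite linearP.
by rewrite !linearD !linearZ.
Qed.

Lemma trunc_ext2_bilinear (U V W : lmodType K) (b : {bilinear U -> V -> W}) :
  bilinear_for *:%R *:%R (trunc_ext2 b).
Proof.
split=> [[z0 z1] p|[z0 z1] p] [x0 x1] [y0 y1]; congr pair; rewrite /=.
- by rewrite linearPl.
- by rewrite !linearDl !linearZl_LR /= scalerDr addrACA addrA !addrA.
- by rewrite linearPr.
- rewrite !linearDr !linearZr_LR /= scalerDr addrACA.
  by congr (_ + _); rewrite addrAC.
Qed.

Section Deformation.

Variables (g V : lmodType K) (br : g -> g -> g) (rho : g -> V -> V).
Variables (T : V -> g).
Variables (omega : g -> g -> g) (varrho : g -> V -> V) (calT : V -> g).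

Definition deformed_bracket (x y : trunc g) : trunc g :=
  trunc_ext2 br x y + 'qX *: trunc_ext2 omega x y.

Definition deformed_rep (x : trunc g) (u : trunc V) : trunc V :=
  trunc_ext2 rho x u + 'qX *: trunc_ext2 varrho x u.

Definition deformed_map (u : trunc V) : trunc g :=
  trunc_ext1 T u + 'qX *: trunc_ext1 calT u.

Record generates_infinitesimal_deformation : Prop :=
  GeneratesInfinitesimalDeformation {
  deformation_lie : is_lie_bracket deformed_bracket;
  deformation_rep : is_lie_rep deformed_bracket deformed_rep;
  deformation_leibniz : forall u v : V,
    let Tt := fun w : V => deformed_map (trunc_const w) in
    deformed_bracket (Tt u) (Tt v)
      = deformed_map (deformed_rep (Tt u) (trunc_const v)) }.

End Deformation.

End Truncation.

(* Arguments x_1, ..., x_n are families x : 'I_n -> U, indexed from 0, so that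
   a sign (-1)^i of the 1-based formulas becomes (-1) ^+ i.+1.  The family x
   with x_i omitted is x \o lift i; with x_j replaced by y it is
   [eta x with j |-> y]. *)
Section Multilinear.

Variables (K : fieldType) (U W : lmodType K) (n : nat).
Variable f : ('I_n -> U) -> W.

Definition multilinear : Prop :=
  forall (i : 'I_n) (x : 'I_n -> U), linear (fun u => f [eta x with i |-> u]).

Definition alternating : Prop :=
  forall (x : 'I_n -> U) (i j : 'I_n), i != j -> x i = x j -> f x = 0.

End Multilinear.

Definition fcons (U : Type) n (u : U) (x : 'I_n -> U) (k : 'I_n.+1) : U :=
  oapp x u (unlift ord0 k).

Section RegularComplex.

Variables (K : fieldType) (g V : lmodType K).

(* The three components of a cochain of degree n = m + 1, m >= 0 (the degree 0
   term of the regular complex is zero). *)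
Record cochain (m : nat) := Cochain {
  cochain_g : ('I_m.+1 -> g) -> g;
  cochain_V : ('I_m -> g) -> V -> V;
  cochain_T : ('I_m -> V) -> g }.

Record in_regular_complex m (c : cochain m) : Prop := InRegularComplex {
  cochain_g_multilinear : multilinear (cochain_g c);
  cochain_g_alternating : alternating (cochain_g c);
  cochain_V_linear : forall x, linear (cochain_V c x);
  cochain_V_multilinear : forall v, multilinear (cochain_V c ^~ v);
  cochain_V_alternating : forall v, alternating (cochain_V c ^~ v);
  cochain_T_multilinear : multilinear (cochain_T c) }.

Variables (br : g -> g -> g) (rho : g -> V -> V) (T : V -> g).

(* In the second sum the pairs i < j are enumerated by j : 'I_m.+2 and
   i : 'I_m.+1, since for i < j the element x_i is x (lift j i). *)
Definition d_CE m (f : ('I_m.+1 -> g) -> g) (x : 'I_m.+2 -> g) : g :=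
  \sum_(i < m.+2) (-1) ^+ i *: br (x i) (f (x \o lift i))
  + \sum_(j < m.+2) \sum_(i < m.+1 | (i < j)%N)
      (-1) ^+ (i + j) *:
        f (fcons (br (x (lift j i)) (x j)) (x \o lift j \o lift i)).

Definition delta_V m (fg : ('I_m.+1 -> g) -> g) (fV : ('I_m -> g) -> V -> V)
    (x : 'I_m.+1 -> g) (v : V) : V :=
  \sum_(i < m.+1) \sum_(j < m.+1 | (i < j)%N)
      (-1) ^+ i.+1 *: fV ([eta x with j |-> br (x i) (x j)] \o lift i) v
  + (-1) ^+ m *: rho (fg x) v
  + \sum_(i < m.+1) (-1) ^+ i *:
      (rho (x i) (fV (x \o lift i) v) - fV (x \o lift i) (rho (x i) v)).

Definition partial_T k (theta : ('I_k -> V) -> g) (u : 'I_k.+1 -> V) : g :=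
  \sum_(i < k.+1 | (i < k)%N)
      (-1) ^+ i *: br (T (u i)) (theta (u \o lift i))
  + (-1) ^+ k.+1 *: br (theta (u \o lift ord_max)) (T (u ord_max))
  + (-1) ^+ k *: T (rho (theta (u \o lift ord_max)) (u ord_max))
  + \sum_(i < k.+1) \sum_(j < k.+1 | (i < j)%N)
      (-1) ^+ i.+1 *:
        theta ([eta u with j |-> rho (T (u i)) (u j)] \o lift i).

Definition Omega_T m (fg : ('I_m.+1 -> g) -> g) (fV : ('I_m -> g) -> V -> V)
    (v : 'I_m.+1 -> V) : g :=
  (-1) ^+ m.+1 *:
    (fg (T \o v) - T (fV (T \o (v \o lift ord_max)) (v ord_max))).

Definition regular_differential m (c : cochain m) : cochain m.+1 :=
  Cochain (d_CE (cochain_g c))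
          (delta_V (cochain_g c) (cochain_V c))
          (fun v => partial_T (cochain_T c) v
                    + Omega_T (cochain_g c) (cochain_V c) v).

Definition is_zero_cochain m (c : cochain m) : Prop :=
  [/\ forall x, cochain_g c x = 0,
      forall x v, cochain_V c x v = 0 &
      forall u, cochain_T c u = 0].

Definition is_cocycle m (c : cochain m) : Prop :=
  in_regular_complex c /\ is_zero_cochain (regular_differential c).

(* The triple (omega, varrho, calT) as an element of
   C^2 = Hom(/\^2 g, g) (+) Hom(g (x) V, V) (+) Hom(V, g). *)
Definition cochain2 (omega : g -> g -> g) (varrho : g -> V -> V)
    (calT : V -> g) : cochain 1 :=
  @Cochain 1 (fun x => omega (x ord0) (x ord_max))
             (fun x v => varrho (x ord0) v)
             (fun u => calT (u ord0)).

Lemma cochain2P (omega : {bilinear g -> g -> g})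
    (varrho : {bilinear g -> V -> V}) (calT : {linear V -> g}) :
  (forall x, omega x x = 0) -> in_regular_complex (cochain2 omega varrho calT).
Proof.
move=> omega_alt; split=> /=.
- move=> i x a u v /=.
  by case: (unliftP ord0 i) => [k|] ->; rewrite ?ord1 /= ?linearPl ?linearPr.
- move=> x i j.
  case: (unliftP ord0 i) => [k|] ->; case: (unliftP ord0 j) => [l|] ->;
    rewrite ?ord1 //= => _.
    have -> : lift ord0 ord0 = ord_max :> 'I_2 by apply: val_inj.
    by move=> ->.
  have -> : lift ord0 ord0 = ord_max :> 'I_2 by apply: val_inj.
  by move=> ->.
- by move=> x a u v /=; rewrite linearPr.
- by move=> v i x a u w /=; rewrite (ord1 i) /= linearPl.
- by move=> v x i j; rewrite !ord1.
- by move=> i x a u v /=; rewrite (ord1 i) /= linearP.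
Qed.

End RegularComplex.

(* Main.v *)
(* Given the axioms of the undeformed triple, each axiom of the deformed one
   fails exactly by t times a component of D(omega, varrho, calT), evaluated at
   the constant terms of the arguments. *)
Require Import Defs.
From HB Require Import structures.
From mathcomp Require Import all_boot all_order all_algebra.
Import GRing.Theory.
Local Open Scope ring_scope.

(** Since t^2 = 0, each identity of the deformed triple splits into its coefficients of 1 and t. The
    constant one is the identity of the original triple. In the other, the terms free of [omega],
    [varrho] and [calT] are original identities with one argument replaced by its t-coefficient, so
    they cancel; what is left is the linearization of the identity, which is a component of D.
    [deformed_jacobi_defect], [deformed_rep_defect] and [deformed_leibniz_defect] prove this for the
    three identities. Bilinearity and alternation of the deformed structure are automatic, and
    [cochain2P] puts the triple of maps in the complex. *)

Lemma bilinear_for_addZ (R : comNzRingType) (U V W : lmodType R)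
    (b c : U -> V -> W) (a : R) :
    bilinear_for *:%R *:%R b -> bilinear_for *:%R *:%R c ->
  bilinear_for *:%R *:%R (fun x y => b x y + a *: c x y).
Proof.
move=> [bl br] [cl cr]; split=> z k x y /=.
  by rewrite [b _ _]bl [c _ _]cl !scalerDr !scalerA addrACA (mulrC a).
by rewrite [b _ _]br [c _ _]cr !scalerDr !scalerA addrACA (mulrC a).
Qed.

Section ExplicitForms.

Variables (K : fieldType) (g V : lmodType K).
Variables (br omega : g -> g -> g) (rho varrho : g -> V -> V).
Variables (T calT : V -> g).

Lemma deformed_bracketE x y :
  deformed_bracket br omega x y
    = (br x.1 y.1, br x.1 y.2 + br x.2 y.1 + omega x.1 y.1).
Proof. by rewrite /deformed_bracket trunc_tE; congr pair; rewrite /= addr0. Qed.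

Lemma deformed_repE x u :
  deformed_rep rho varrho x u
    = (rho x.1 u.1, rho x.1 u.2 + rho x.2 u.1 + varrho x.1 u.1).
Proof. by rewrite /deformed_rep trunc_tE; congr pair; rewrite /= addr0. Qed.

Lemma deformed_mapE u :
  deformed_map T calT u = (T u.1, T u.2 + calT u.1).
Proof. by rewrite /deformed_map trunc_tE; congr pair; rewrite /= addr0. Qed.

Let ord0E n : ord0 = 0 :> 'I_n.+1. Proof. by []. Qed.

Let sgnE :=
  (addn0, add0n, add1n, @exprS K, @expr0 K, @mulr1 K, @mulN1r K, @opprK K).

(** This and the next three lemmas unfold D in degree 2, listing the terms in the order in which the
    defect computations produce them. *)
Lemma d_CE2 (x : 'I_3 -> g) :
  d_CE br (cochain_g (cochain2 omega varrho calT)) x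
    = br (x 0) (omega (x 1) (x ord_max)) - br (x 1) (omega (x 0) (x ord_max))
      + br (x ord_max) (omega (x 0) (x 1)) - omega (br (x 0) (x 1)) (x ord_max)
      + omega (br (x 0) (x ord_max)) (x 1) - omega (br (x 1) (x ord_max)) (x 0).
Proof.
(* These equations normalize the indices created by [lift], [unlift] and [ord_max]. *)
have [[e1 e2 e3 e4] [e5 e6] [e7 e8 e9]] :
  [/\ [/\ lift 0 0 = 1 :> 'I_3, lift 0 1 = ord_max :> 'I_3,
          lift ord_max 0 = 0 :> 'I_3 & lift ord_max 1 = 1 :> 'I_3],
      lift 1 0 = 0 :> 'I_3 /\ lift 1 1 = ord_max :> 'I_3
    & [/\ ord_max = 1 :> 'I_2, lift 0 0 = 1 :> 'I_2 & lift 1 0 = 0 :> 'I_2]].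
  by do !split; apply: val_inj.
have e10 : unlift 0 1 = Some 0 :> option 'I_1 by rewrite -e8 liftK.
rewrite /d_CE !big_ord_recl !big_ord0 /=.
(* The guard i < j moves into the summand, since [big_ord_recl] expands only unfiltered sums; it
   then evaluates. *)
rewrite !(big_mkcond (fun i : 'I_2 => (i < _)%N)) /=.
rewrite !big_ord_recl !big_ord0 /= /fcons !ord0E /bump /=.
rewrite !(e1, e2, e3, e4, e5, e6, e7, e8, e9, e10) !unlift_none /=.
rewrite e9 !e8 e3 e4 e6 !sgnE !scaleN1r !scale1r.
by rewrite !(add0r, addr0) !addrA.
Qed.

Lemma delta_V2 (x : 'I_2 -> g) v :
  delta_V br rho (cochain_g (cochain2 omega varrho calT))
      (cochain_V (cochain2 omega varrho calT)) x v
    = - varrho (br (x 0) (x 1)) v - rho (omega (x 0) (x 1)) v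
      + rho (x 0) (varrho (x 1) v) - varrho (x 1) (rho (x 0) v)
      - rho (x 1) (varrho (x 0) v) + varrho (x 0) (rho (x 1) v).
Proof.
have [e1 e2 e3] : [/\ lift 0 0 = 1 :> 'I_2, lift 1 0 = 0 :> 'I_2 &
  ord_max = 1 :> 'I_2] by split; apply: val_inj.
rewrite /delta_V !big_ord_recl !big_ord0 /=.
rewrite !(big_mkcond (fun i : 'I_2 => (_ < i)%N)) /=.
rewrite !big_ord_recl !big_ord0 /= !ord0E /bump /= !(e1, e2, e3) /=.
rewrite !sgnE !scaleN1r !scale1r !(add0r, addr0).
by rewrite opprB (addrC (varrho _ _)) !addrA.
Qed.

Lemma partial_T1 (u : 'I_2 -> V) :
  partial_T br rho T (cochain_T (cochain2 omega varrho calT)) u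
    = br (T (u 0)) (calT (u 1)) + br (calT (u 0)) (T (u 1))
      - T (rho (calT (u 0)) (u 1)) - calT (rho (T (u 0)) (u 1)).
Proof.
have [e1 e2 e3] : [/\ lift 0 0 = 1 :> 'I_2, lift 1 0 = 0 :> 'I_2 &
  ord_max = 1 :> 'I_2] by split; apply: val_inj.
rewrite /partial_T !(big_mkcond (fun i : 'I_2 => (i < _)%N)).
rewrite !big_ord_recl !big_ord0 /= !(big_mkcond (fun i : 'I_2 => (_ < i)%N)).
rewrite !big_ord_recl !big_ord0 /= !ord0E /bump /= !(e1, e2, e3) /=.
by rewrite !sgnE !scaleN1r !scale1r !(add0r, addr0).
Qed.

Lemma Omega_T2 (u : 'I_2 -> V) :
  Omega_T T (cochain_g (cochain2 omega varrho calT))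
      (cochain_V (cochain2 omega varrho calT)) u
    = omega (T (u 0)) (T (u 1)) - T (varrho (T (u 0)) (u 1)).
Proof.
have [e2 e3] : lift 1 0 = 0 :> 'I_2 /\ ord_max = 1 :> 'I_2.
  by split; apply: val_inj.
by rewrite /Omega_T /= e3 e2 -signr_odd /= scale1r.
Qed.

End ExplicitForms.

(** Polarization: expand b (x + y) (x + y) = 0. *)
Lemma alternating_skew (R : comNzRingType) (U W : lmodType R)
    (b : {bilinear U -> U -> W}) :
  (forall x, b x x = 0) -> forall x y, b x y = - b y x.
Proof.
move=> b_alt x y; have := b_alt (x + y).
rewrite linearDl !linearDr !b_alt add0r addr0 => /eqP.
by rewrite addr_eq0 => /eqP.
Qed.

Section Defects.

Variables (K : fieldType) (g V : lmodType K).
Variables (br omega : {bilinear g -> g -> g}).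
Variables (rho varrho : {bilinear g -> V -> V}) (T calT : {linear V -> g}).
Hypothesis triple : is_lie_leibniz_triple br rho T.
Hypothesis omega_alt : forall x, omega x x = 0.

Let br_lie := triple_lie triple.
Let rho_rep := triple_rep triple.

Let D := regular_differential br rho T (cochain2 omega varrho calT).

(** The t-coefficient is [x0, x1] + [x1, x0] + [omega] x0 x0, where x = x0 + t x1. *)
Lemma deformed_bracket_alt x : deformed_bracket br omega x x = 0.
Proof.
rewrite deformed_bracketE (lie_alternating br_lie) omega_alt addr0.
by rewrite (alternating_skew _ _ _ _ (lie_alternating br_lie)) addNr.
Qed.

Lemma deformed_jacobi_defect (x : 'I_3 -> trunc g) :
  let br_t := deformed_bracket br omega in
  br_t (x 0) (br_t (x 1) (x ord_max)) + br_t (x 1) (br_t (x ord_max) (x 0))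
      + br_t (x ord_max) (br_t (x 0) (x 1))
    = (0, cochain_g D (fun i => (x i).1)).
Proof.
rewrite [cochain_g D _]d_CE2 /= !deformed_bracketE.
move: (x 0) (x 1) (x ord_max) => {}x y z; congr pair; rewrite /=.
  exact: lie_jacobi br_lie _ _ _.
rewrite /= !linearDr /= !addrA.
(* The first three groups are Jacobi sums for br, each with one argument
   replaced by its coefficient of t; they vanish. *)
rewrite [LHS](ACl ((1*7*14)*(2*9*11)*(4*6*12)*(3*8*13*15*10*5))) /=.
rewrite !(lie_jacobi br_lie) !add0r.
have skew_b := alternating_skew _ _ _ _ (lie_alternating br_lie).
have skew_o := alternating_skew _ _ _ _ omega_alt.
(* The six remaining terms are cyclic in x, y, z; skew-symmetry gives them the signs and argument
   order of [d_CE2]. *)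
rewrite (skew_o z.1 x.1) linearNr (skew_o z.1 (br _ _)) (skew_o x.1 (br _ _)).
by rewrite (skew_o y.1 (br _ _)) (skew_b z.1 x.1) linearNl opprK.
Qed.

Lemma deformed_rep_defect (x : 'I_2 -> trunc g) u :
  let rho_t := deformed_rep rho varrho in
  rho_t (x 0) (rho_t (x 1) u) - rho_t (x 1) (rho_t (x 0) u)
      - rho_t (deformed_bracket br omega (x 0) (x 1)) u
    = (0, cochain_V D (fun i => (x i).1) u.1).
Proof.
rewrite [cochain_V D _ _]delta_V2 /= deformed_bracketE !deformed_repE.
move: (x 0) (x 1) => {}x y; congr pair; rewrite /=.
  by rewrite (rep_bracket rho_rep) subrr.
rewrite !linearDr !linearDl /= !opprD !addrA.
(* The first three groups are the identity [rep_bracket] with the t-coefficient taken in u, y and x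
   respectively; the last is [delta_V2]. *)
rewrite [LHS](ACl ((1*6*11)*(2*9*12)*(4*7*13)*(15*14*3*10*8*5))) /=.
by rewrite !(rep_bracket rho_rep) !subrr !add0r.
Qed.

Lemma deformed_leibniz_defect (u : 'I_2 -> V) :
  let Tt w := deformed_map T calT (trunc_const w) in
  deformed_bracket br omega (Tt (u 0)) (Tt (u 1))
      - deformed_map T calT (deformed_rep rho varrho (Tt (u 0))
          (trunc_const (u 1)))
    = (0, cochain_T D u).
Proof.
rewrite -[cochain_T D _]/(partial_T _ _ _ _ _ + Omega_T _ _ _ _).
rewrite partial_T1 Omega_T2 /=.
rewrite !(deformed_mapE, deformed_bracketE, deformed_repE).
move: (u 0) (u 1) => {}u v; congr pair; rewrite /=.
  by rewrite (triple_leibniz triple) subrr.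
(* The arguments u and v are constant, so the terms in their t-coefficients vanish. The first four
   terms of the regrouping below are [partial_T1], the last two [Omega_T2]. *)
rewrite linear0r !linear0 !add0r !linearD /= !addrA.
by rewrite [LHS](ACl (1*2*4*6*3*5)).
Qed.

Lemma generates_infinitesimal_deformationE :
  generates_infinitesimal_deformation br rho T omega varrho calT
    <-> is_zero_cochain D.
Proof.
split=> [[br_t_lie rho_t_rep leibniz_t]|[D_g0 D_V0 D_T0]].
  split=> [x|x v|u].
  (* Constant arguments already reach every value of the component of D. *)
  - have := deformed_jacobi_defect (fun i => trunc_const (x i)).
    by rewrite /= (lie_jacobi br_t_lie) => -[].
  - have := deformed_rep_defect (fun i => trunc_const (x i)) (trunc_const v).
    by rewrite /= (rep_bracket rho_t_rep) subrr => -[].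
  - by have := deformed_leibniz_defect u; rewrite /= leibniz_t subrr => -[].
split.
- split.
  + by apply: bilinear_for_addZ; apply: trunc_ext2_bilinear.
  + exact: deformed_bracket_alt.
  + move=> x y z; have := deformed_jacobi_defect (tnth [tuple x; y; z]).
    by rewrite D_g0.
- split.
  + by apply: bilinear_for_addZ; apply: trunc_ext2_bilinear.
  + move=> x y u; apply/esym/eqP; rewrite -subr_eq0; apply/eqP.
    have := deformed_rep_defect (tnth [tuple x; y]) u.
    by rewrite D_V0.
- move=> u v Tt; apply/eqP; rewrite -subr_eq0; apply/eqP.
  have := deformed_leibniz_defect (tnth [tuple u; v]).
  by rewrite D_T0.
Qed.

End Defects.

Section BilinearForPack.

Variables (R : comNzRingType) (U V W : lmodType R) (b : U -> V -> W).
Hypothesis b_bilinear : bilinear_for *:%R *:%R b.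

HB.instance Definition _ :=
  bilinear_isBilinear.Build R U V W *:%R *:%R b b_bilinear.

(** The triple has plain functions [br] and [rho], while the defect lemmas take bundled bilinear
    maps; this equation allows substituting one for the other. *)
Lemma bilinear_for_pack : exists c : {bilinear U -> V -> W}, b = c.
Proof. by exists b. Qed.

End BilinearForPack.

Theorem proposition5p8 (K : fieldType) (g V : lmodType K)
    (br : g -> g -> g) (rho : g -> V -> V) (T : {linear V -> g})
    (omega : {bilinear g -> g -> g}) (varrho : {bilinear g -> V -> V})
    (calT : {linear V -> g}) :
  is_lie_leibniz_triple br rho T ->
  (forall x, omega x x = 0) ->
  generates_infinitesimal_deformation br rho T omega varrho calT
    <-> is_cocycle br rho T (cochain2 omega varrho calT).
Proof.
move=> triple omega_alt.
have [br' br_E] :=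
  bilinear_for_pack _ _ _ _ _ (lie_bilinear (triple_lie triple)).
have [rho' rho_E] :=
  bilinear_for_pack _ _ _ _ _ (rep_bilinear (triple_rep triple)).
subst br rho; have generatesE :=
  generates_infinitesimal_deformationE _ _ _ _ _ _ varrho _ calT triple omega_alt.
split=> [/generatesE D0|[_ /generatesE]] //.
by split=> //; apply: cochain2P.
Qed.
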